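(* Let $R$ be a commutative ring with non-zero identity, $M$ a unital $R$-module, and $T$ a non-empty subset of $\mathrm{Max}(M)$. Let $\Im(T)$ be the intersection of all members of $T$. Suppose $N/\Im(T)$ and $L/\Im(T)$ are adjacent in $AG(M/\Im(T))$, where $N,L$ are submodules of $M$ containing $\Im(T)$. Then $N$ and $L$ are adjacent in $G(\tau^{m}_{T})$ if one of the following conditions holds. (a) $M/\Im(T)$ is not a vertex in $AG(M/\Im(T))$. In particular, this holds when $M/\Im(T)$ is finitely generated and there is no semi maximal submodule $S$ of $M$ with $S\supseteq \Im(T)$, $S\neq \Im(T)$ and $V^{m}(S)=T$. (b) $M/N$ and $M/L$ are Max-surjective, and there is no semi maximal submodule $S$ of $M$ with $S\supseteq N$ or $S\supseteq L$ such that $S\neq \Im(T)$ and $V^{m}(S)=T$.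
   Context: $\mathrm{Max}(M)$ is the set of maximal submodules of $M$. For $N\leq M$, $(N:M)=\{r\in R: rM\subseteq N\}$ and $V^{m}(N)=\{Q\in \mathrm{Max}(M):(Q:M)\supseteq (N:M)\}$. A semi maximal submodule of $M$ is an intersection of a non-empty family of maximal submodules of $M$. An $R$-module $M'$ is Max-surjective if either $M'=0$, or $M'\neq 0$ and the natural map $\mathrm{Max}(M')\to \mathrm{Max}(R/\mathrm{Ann}(M'))$, $Q\mapsto (Q:M')/\mathrm{Ann}(M')$, is surjective. $G(\tau^{m}_{T})$ is the undirected graph whose vertices are the proper submodules $N<M$ for which there exists a proper submodule $L<M$ with $V^{m}(N)\cup V^{m}(L)=T$, $V^{m}(N)\neq T$ and $V^{m}(L)\neq T$; distinct vertices $N$ and $L$ are adjacent if and only if $V^{m}(N)\cup V^{m}(L)=T$. For submodules $N,K$ of an $R$-module $M'$, their product is $NK=(N:M')(K:M')M'$. The annihilating-submodule graph $AG(M')$ has as vertices the non-zero submodules $N\leq M'$ (possibly $N=M'$) for which there exists a non-zero proper submodule $K$ of $M'$ with $NK=0$; distinct vertices $N,L$ are adjacent if and only if $NL=0$.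
   Formalization: The formal theorem additionally assumes T = V^m(K) for some submodule K; without this the claim fails (R = M = Z×Z, T = all maximal ideals except 2Z×Z, N = Z×0, L = 0×Z), and for such T the graph G(τ^m_T) has no vertices. *)

(* Defs.v *)
From HB Require Import structures.
From mathcomp Require Import all_boot all_algebra.
From mathcomp Require Import boolp classical_sets functions.

Set Implicit Arguments.
Unset Strict Implicit.
Unset Printing Implicit Defensive.

Import GRing.Theory.
Local Open Scope ring_scope.
Local Open Scope classical_set_scope.

(* Submodules of [V] are the elements of MathComp's [submodClosed V], and
   ideals of a commutative ring [A] are those of [submodClosed A^o].
   Membership is boolean, so propositions are reflected classically by
   [asbool]; by [submod_ext], Leibniz equality is extensional equality. *)

Section Submodules.
Variables (A : pzRingType) (V : lmodType A).
Implicit Types (N L K Q S : submodClosed V) (F T : set (submodClosed V)).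

Definition mk_submod (P : V -> bool) (hP : submod_closed P) : submodClosed V :=
  HB.pack P (GRing.isSubmodClosed.Build A V P (hP : GRing.subsemimod_closed P)).

Lemma mem_mk_submod (P : V -> bool) (hP : submod_closed P) x :
  (x \in mk_submod hP) = P x.
Proof. by []. Qed.

Lemma submod_ext N L : N =i L -> N = L.
Proof.
case: N L => [N [[ND] [NZ]]] [L [[LD] [LZ]]] NL.
have E : N = L by apply/funext => x; exact: NL.
by case: L / E LD LZ {NL} => LD LZ; rewrite (Prop_irrelevance ND LD)
  (Prop_irrelevance NZ LZ).
Qed.

Fact top_submod_closed : submod_closed (xpredT : V -> bool).
Proof. by []. Qed.
Definition top_submod := mk_submod top_submod_closed.

Fact zero_submod_closed : submod_closed (pred1 (0 : V)).
Proof.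
split=> [|a x y]; rewrite !inE // => /eqP-> /eqP->.
by rewrite scaler0 addr0.
Qed.
Definition zero_submod := mk_submod zero_submod_closed.

Fact cap_submod_closed F :
  submod_closed (fun x : V => `[< forall N, F N -> x \in N >]).
Proof.
split=> [|a x y]; first by apply/asboolP => N _; exact: rpred0.
move=> /asboolP hx /asboolP hy; apply/asboolP => N FN.
by rewrite rpredD ?rpredZ ?hx ?hy.
Qed.
Definition cap_submod F := mk_submod (cap_submod_closed F).

(* the submodule generated by a subset *)
Definition span_submod (X : set V) :=
  cap_submod [set N | forall x, X x -> x \in N].

Definition fin_gen :=
  exists s : seq V, span_submod [set x | x \in s] = top_submod.

Definition Max : set (submodClosed V) :=
  [set Q | Q <> top_submod /\
           forall N, {subset Q <= N} -> N = Q \/ N = top_submod].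

Definition semi_maximal S :=
  exists F, [/\ F !=set0, F `<=` Max & S = cap_submod F].

End Submodules.

Arguments top_submod {A} V.
Arguments zero_submod {A} V.
Arguments fin_gen {A} V.
Arguments Max {A} V.

Section Colon.
Variables (R : comPzRingType) (V : lmodType R).
Implicit Types (N L K Q S : submodClosed V) (T : set (submodClosed V)).

Fact colon_closed N :
  submod_closed (fun r : R^o => `[< forall x : V, (r : R) *: x \in N >]).
Proof.
split=> [|a r s].
  by apply/asboolP => x; rewrite scale0r rpred0.
move=> /asboolP hr /asboolP hs; apply/asboolP => x.
have -> : (a *: r + s : R) *: x = a *: ((r : R) *: x) + (s : R) *: x.
  by rewrite scalerA -scalerDl.
by apply: rpredD; [apply: rpredZ; exact: hr | exact: hs].
Qed.
(* the ideal (N : V) *)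
Definition colon N : submodClosed R^o := mk_submod (colon_closed N).

Definition Ann : submodClosed R^o := colon (zero_submod V).

(* V^m(N) *)
Definition Vm N : set (submodClosed V) :=
  [set Q | Max V Q /\ {subset colon N <= colon Q}].

(* closed in the topology on Max(V) whose closed sets are the V^m(N) *)
Definition Max_closed T := exists N, T = Vm N.

Definition ideal_mul (I J : submodClosed R^o) : submodClosed R^o :=
  span_submod [set z | exists a b, [/\ a \in I, b \in J & z = a * b]].

Definition ideal_smul (I : submodClosed R^o) : submodClosed V :=
  span_submod [set z | exists2 a : R, a \in I & exists x : V, z = a *: x].

Definition submod_mul N K := ideal_smul (ideal_mul (colon N) (colon K)).

Definition AG_vertex N :=
  N <> zero_submod V /\
  exists K, [/\ K <> zero_submod V, K <> top_submod V &
                submod_mul N K = zero_submod V].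

Definition AG_adj N L :=
  [/\ AG_vertex N, AG_vertex L, N <> L & submod_mul N L = zero_submod V].

Definition G_vertex T N :=
  N <> top_submod V /\
  exists L, [/\ L <> top_submod V, Vm N `|` Vm L = T, Vm N <> T & Vm L <> T].

Definition G_adj T N L :=
  [/\ G_vertex T N, G_vertex T L, N <> L & Vm N `|` Vm L = T].

End Colon.

Arguments Ann {R} V.

(* [Quotient.quot] is indexed by a [zmodClosed]; over a ring every
   [submodClosed] is one, but MathComp has no such coercion. *)
Section Zmod.
Variables (A : pzRingType) (V : lmodType A) (N : submodClosed V).

Definition submod_zmod : zmodClosed V :=
  HB.pack (fun x : V => x \in N)
    (GRing.isZmodClosed.Build V (fun x : V => x \in N)
       (submodClosedP N : zmod_closed N)).

Lemma mem_submod_zmod x : (x \in submod_zmod) = (x \in N).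
Proof. by []. Qed.

End Zmod.

Section QuotientModule.
Variables (A : pzRingType) (V : lmodType A) (N : submodClosed V).

Definition quot_mod : Type := Quotient.quot (submod_zmod N).
HB.instance Definition _ := GRing.Zmodule.on quot_mod.

Definition mod_pi (x : V) : quot_mod :=
  \pi_(Quotient.quot (submod_zmod N))%qT x.
Definition mod_repr (q : quot_mod) : V :=
  repr (q : Quotient.quot (submod_zmod N)).

Lemma mod_reprK : cancel mod_repr mod_pi.
Proof. exact: reprK. Qed.

Lemma mod_piD : {morph mod_pi : x y / x + y}.
Proof. by move=> x y; rewrite /mod_pi raddfD. Qed.

Lemma mod_piE x y : (mod_pi x = mod_pi y) <-> (x - y \in N).
Proof.
rewrite -mem_submod_zmod Quotient.idealrBE.
by split=> [/eqP|/eqP].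
Qed.

Definition mod_scale (a : A) (q : quot_mod) : quot_mod :=
  mod_pi (a *: mod_repr q).

Lemma mod_piZ a x : mod_pi (a *: x) = mod_scale a (mod_pi x).
Proof.
apply/mod_piE; rewrite -scalerBr rpredZ //.
by apply/mod_piE; rewrite mod_reprK.
Qed.

Fact mod_scalerA a b q : mod_scale a (mod_scale b q) = mod_scale (a * b) q.
Proof. by rewrite -[q]mod_reprK -!mod_piZ scalerA. Qed.

Fact mod_scale1r : left_id 1 mod_scale.
Proof. by move=> q; rewrite -[q]mod_reprK -mod_piZ scale1r. Qed.

Fact mod_scalerDr : right_distributive mod_scale +%R.
Proof.
move=> a q r; rewrite -[q]mod_reprK -[r]mod_reprK.
by rewrite -mod_piD -!mod_piZ scalerDr mod_piD.
Qed.

Fact mod_scalerDl q : {morph mod_scale^~ q : a b / a + b}.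
Proof.
by move=> a b; rewrite -[q]mod_reprK -!mod_piZ scalerDl mod_piD.
Qed.

HB.instance Definition _ := GRing.Zmodule_isLmodule.Build A quot_mod
  mod_scalerA mod_scale1r mod_scalerDr mod_scalerDl.

Fact quot_submod_closed (K : submodClosed V) :
  submod_closed (fun q : quot_mod => `[< exists2 x, x \in K & mod_pi x = q >]).
Proof.
split=> [|a q r].
  by apply/asboolP; exists 0; rewrite ?rpred0 // /mod_pi raddf0.
move=> /asboolP[x Kx <-] /asboolP[y Ky <-]; apply/asboolP.
by exists (a *: x + y); rewrite ?rpredD ?rpredZ // mod_piD mod_piZ.
Qed.
(* K / N, for K containing N (the image of K in V / N in general) *)
Definition quot_submod (K : submodClosed V) : submodClosed quot_mod :=
  mk_submod (quot_submod_closed K).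

End QuotientModule.

(* The quotient ring R / I; MathComp's {ideal_quot I} requires I to be proper,
   whereas a [comPzRingType] allows the zero ring. *)
Section QuotientRing.
Variables (R : comPzRingType) (I : submodClosed R^o).

Definition quot_ring : Type := quot_mod I.
HB.instance Definition _ := GRing.Zmodule.on quot_ring.

Definition ring_pi (x : R) : quot_ring := mod_pi I (x : R^o).
Definition ring_repr (q : quot_ring) : R := mod_repr q.

Lemma ring_reprK : cancel ring_repr ring_pi.
Proof. exact: mod_reprK. Qed.

Lemma ring_piD : {morph ring_pi : x y / x + y}.
Proof. by move=> x y; exact: (@mod_piD _ _ I (x : R^o) y). Qed.

Lemma ring_piE (x y : R) : (ring_pi x = ring_pi y) <-> ((x - y : R^o) \in I).
Proof. exact: (@mod_piE _ _ I (x : R^o) y). Qed.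

Definition ring_mul (p q : quot_ring) : quot_ring :=
  ring_pi (ring_repr p * ring_repr q).

Lemma ring_piM x y : ring_pi (x * y) = ring_mul (ring_pi x) (ring_pi y).
Proof.
set x' := ring_repr (ring_pi x); set y' := ring_repr (ring_pi y).
have hx : (x - x' : R^o) \in I by apply/ring_piE; rewrite ring_reprK.
have hy : (y - y' : R^o) \in I by apply/ring_piE; rewrite ring_reprK.
apply/ring_piE; rewrite -/x' -/y'.
have -> : x * y - x' * y' = y * (x - x') + x' * (y - y').
  by rewrite !mulrBr addrA (mulrC y x) (mulrC y x') subrK.
by apply: rpredD; [exact: (rpredZ y hx) | exact: (rpredZ x' hy)].
Qed.

Fact ring_mulA : associative ring_mul.
Proof.
move=> p q r; rewrite -[p]ring_reprK -[q]ring_reprK -[r]ring_reprK.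
by rewrite -!ring_piM mulrA.
Qed.

Fact ring_mulC : commutative ring_mul.
Proof. by move=> p q; rewrite /ring_mul mulrC. Qed.

Fact ring_mul1r : left_id (ring_pi 1) ring_mul.
Proof. by move=> q; rewrite -[q]ring_reprK -ring_piM mul1r. Qed.

Fact ring_mulDl : left_distributive ring_mul +%R.
Proof.
move=> p q r; rewrite -[p]ring_reprK -[q]ring_reprK -[r]ring_reprK.
by rewrite -ring_piD -!ring_piM mulrDl ring_piD.
Qed.

HB.instance Definition _ := GRing.Zmodule_isComPzRing.Build quot_ring
  ring_mulA ring_mulC ring_mul1r ring_mulDl.

Fact quot_ideal_closed (J : submodClosed R^o) :
  submod_closed (fun q : quot_ring^o =>
    `[< exists2 x : R, (x : R^o) \in J & ring_pi x = q >]).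
Proof.
split=> [|a q r].
  by apply/asboolP; exists 0; rewrite ?rpred0 // /ring_pi /mod_pi raddf0.
move=> /asboolP[x Jx <-] /asboolP[y Jy <-]; apply/asboolP.
exists (ring_repr a * x + y); first by apply: rpredD => //; exact: (rpredZ (ring_repr a) Jx).
by rewrite ring_piD ring_piM ring_reprK.
Qed.
(* J / I, for J containing I *)
Definition quot_ideal (J : submodClosed R^o) : submodClosed quot_ring^o :=
  mk_submod (quot_ideal_closed J).

End QuotientRing.

Definition Max_surjective (R : comPzRingType) (V : lmodType R) :=
  (forall x : V, x = 0) \/
  ((exists x : V, x <> 0) /\
   set_surj (Max V) (Max (quot_ring (Ann V))^o)
     (fun Q => quot_ideal (Ann V) (colon Q))).

(* Main.v *)
(* Write [J] for the intersection of [T], so that [V^m(J) = T].  As [(Q : M)] is a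
   maximal ideal for each [Q] in [T], [(N : M)(L : M)M <= J] gives
   [V^m(N) U V^m(L) = T], and all that remains is that neither [(N : M)] nor
   [(L : M)] lies in [(J : M)].  If [(X : M) <= (J : M)] with [X > J] proper, then
   [(M/J)(X/J) = 0] and [M/J] is a vertex; and if moreover every [(P : M)] with
   [P] in [T] contains some [(Q : M)] with [Q >= X] maximal, the intersection [S]
   of the maximal submodules above [X] satisfies [V^m(S) = T] and [S <> J].  Such
   [Q] exist when [M/X] is Max-surjective, and also when it is finitely
   generated. *)

Require Import Defs.
From mathcomp Require Import all_boot all_algebra.
From mathcomp Require Import boolp classical_sets functions.

Set Implicit Arguments.
Unset Strict Implicit.
Unset Printing Implicit Defensive.

Import GRing.Theory.
Local Open Scope ring_scope.
Local Open Scope classical_set_scope.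

(** * Adjoining an element, Zorn's lemma and chains of submodules *)

Section Submodules.
Variables (A : pzRingType) (V : lmodType A).
Implicit Types (N K Q : submodClosed V) (F : set (submodClosed V)).

Lemma submodB N x y : x \in N -> y \in N -> x - y \in N.
Proof. by move=> Nx Ny; rewrite -scaleN1r rpredD ?rpredZ. Qed.

Lemma mem_cap_submod F x :
  (x \in cap_submod F) <-> (forall N, F N -> x \in N).
Proof. by split=> /asboolP. Qed.

Lemma span_submod_min (X : set V) N :
  (forall x, X x -> x \in N) -> {subset span_submod X <= N}.
Proof. by move=> XN x /mem_cap_submod; apply. Qed.

Lemma span_submod_gen (X : set V) x : X x -> x \in span_submod X.
Proof. by move=> Xx; apply/mem_cap_submod => N; apply. Qed.

Lemma zero_submodE x : (x \in zero_submod V) = (x == 0).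
Proof. by []. Qed.

Lemma top_submodP N : (forall x, x \in N) <-> N = top_submod V.
Proof. by split=> [hN|-> //]; apply: submod_ext => x; rewrite hN. Qed.

Lemma zero_submodP N : {subset N <= zero_submod V} <-> N = zero_submod V.
Proof.
split=> [hN|-> //]; apply: submod_ext => x; apply/idP/idP => [/hN //|].
by rewrite zero_submodE => /eqP->; exact: rpred0.
Qed.

(** The predicate describes [N + A x], the summand in [N] being written as [y - a *: x]. *)
Fact adjoin_submod_closed N (x : V) :
  submod_closed (fun y : V => `[< exists a : A, y - a *: x \in N >]).
Proof.
split=> [|c y z].
  by apply/asboolP; exists 0; rewrite scale0r subr0 rpred0.
move=> /asboolP[a ha] /asboolP[b hb]; apply/asboolP; exists (c * a + b).
have -> : c *: y + z - (c * a + b) *: x = c *: (y - a *: x) + (z - b *: x).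
  by rewrite scalerDl scalerBr scalerA opprD addrACA.
by rewrite rpredD ?rpredZ.
Qed.
Definition adjoin_submod N x := mk_submod (adjoin_submod_closed N x).

Lemma mem_adjoin_submod N x y :
  (y \in adjoin_submod N x) <-> (exists a : A, y - a *: x \in N).
Proof. by split=> /asboolP. Qed.

Lemma sub_adjoin_submod N x : {subset N <= adjoin_submod N x}.
Proof.
by move=> y Ny; apply/mem_adjoin_submod; exists 0; rewrite scale0r subr0.
Qed.

Lemma adjoin_submod_gen N x : x \in adjoin_submod N x.
Proof.
by apply/mem_adjoin_submod; exists 1; rewrite scale1r subrr rpred0.
Qed.

(** As [Q + A x] is strictly larger than the maximal [Q], it is the whole module. *)
Lemma Max_adjoin Q x y : Max V Q -> x \notin Q ->
  exists a : A, y - a *: x \in Q.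
Proof.
move=> [_ maxQ] xQ; apply/mem_adjoin_submod.
case: (maxQ _ (@sub_adjoin_submod Q x)) => [E|->//].
by move: xQ; rewrite -E adjoin_submod_gen.
Qed.

(** Any submodule strictly above [Q] contains some [Q + A x] with [x] outside [Q], so it is enough
    to test these. *)
Lemma MaxI Q : Q <> top_submod V ->
  (forall x, x \notin Q -> adjoin_submod Q x = top_submod V) -> Max V Q.
Proof.
move=> Qtop adj; split=> // N QN.
have [NQ|/existsNP[x /not_implyP[Nx /negP xQ]]] := pselect {subset N <= Q}.
  by left; apply: submod_ext => x; apply/idP/idP => [/NQ|/QN].
right; apply/top_submodP => y.
have : y \in adjoin_submod Q x by rewrite adj.
move=> /mem_adjoin_submod[a /QN Nya].
by have := rpredD Nya (rpredZ a Nx); rewrite subrK.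
Qed.

(** Zorn's lemma on the subtype of members of [C], ordered by inclusion. Bounds are asked for
    non-empty chains; any member of [C] bounds the empty one. *)
Lemma Zorn_submod (C : set (submodClosed V)) : C !=set0 ->
  (forall F, F !=set0 -> F `<=` C -> total_on F (fun K N => {subset K <= N}) ->
     exists2 U, C U & forall K, F K -> {subset K <= U}) ->
  exists2 K, C K & forall N, C N -> {subset K <= N} -> N = K.
Proof.
move=> [K0 CK0] ub.
pose R (s t : {K | C K}) := `[< {subset sval s <= sval t} >].
have [t|r s t|s t|B Btot|[K CK] maxK] := @Zorn {K | C K} R.
- exact/asboolP.
- by move=> /asboolP rs /asboolP st; apply/asboolP => x /rs/st.
- case: s t => [s Cs] [t Ct] /asboolP st /asboolP ts; apply: eq_exist.
  by apply: submod_ext => x; apply/idP/idP => [/st|/ts].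
- have [[a Ba]|B0] := pselect (B !=set0); last first.
    by exists (exist _ K0 CK0) => s Bs; case: B0; exists s.
  have [||_ _ [s Bs <-] [t Bt <-]|U CU BU] := ub [set sval s | s in B].
  + by exists (sval a), a.
  + by move=> _ [s _ <-]; exact: svalP.
  + by case: (Btot s t Bs Bt) => /asboolP; [left|right].
  + by exists (exist _ U CU) => s Bs; apply/asboolP; apply: BU; exists s.
- exists K => // N CN KN.
  by have /(congr1 sval) := maxK (exist _ N CN) (introT (asboolP _) KN).
Qed.

(** The union of a non-empty chain: two elements lie together in the larger of their two members. *)
Fact chain_submod_closed F : F !=set0 ->
  total_on F (fun K N => {subset K <= N}) ->
  submod_closed (fun x : V => `[< exists2 K, F K & x \in K >]).
Proof.
move=> [K0 FK0] tot; split=> [|a x y].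
  by apply/asboolP; exists K0; rewrite ?rpred0.
move=> /asboolP[K FK Kx] /asboolP[N FN Ny]; apply/asboolP.
case: (tot K N FK FN) => [/(_ _ Kx) Nx|/(_ _ Ny) Ky].
  by exists N; rewrite ?rpredD ?rpredZ.
by exists K; rewrite ?rpredD ?rpredZ.
Qed.

(** By induction, keeping the larger of two members of the chain. It brings finite generation into
    the Zorn argument. *)
Lemma chain_finite F (s : seq V) : F !=set0 ->
  total_on F (fun K N => {subset K <= N}) ->
  (forall x, x \in s -> exists2 K, F K & x \in K) ->
  exists2 K, F K & {subset s <= K}.
Proof.
move=> [K0 FK0] tot; elim: s => [|x s IHs] sF; first by exists K0.
have [K FK Kx] := sF x (mem_head x s).
have [|N FN sN] := IHs; first by move=> y ys; apply: sF; rewrite inE ys orbT.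
case: (tot K N FK FN) => [KN|NK].
  by exists N => // y; rewrite inE => /predU1P[->|/sN//]; exact: KN.
by exists K => // y; rewrite inE => /predU1P[->//|/sN/NK].
Qed.

End Submodules.

(** * The submodule of elements that a scalar sends into [N] *)

Section Transporter.
Variables (R : comPzRingType) (V : lmodType R).
Implicit Types (N : submodClosed V).

(** Commutativity of [R] makes this a submodule. An inclusion [r V <= N] can then be proved by
    showing that the transporter is all of [V]. *)
Fact transporter_closed N (r : R) : submod_closed (fun y : V => r *: y \in N).
Proof.
have memE y : (y \in (fun y : V => r *: y \in N)) = (r *: y \in N) by [].
split=> [|a x y]; rewrite !memE; first by rewrite scaler0 rpred0.
by move=> hx hy; rewrite scalerDr scalerA mulrC -scalerA rpredD ?(rpredZ a).
Qed.
Definition transporter N r := mk_submod (transporter_closed N r).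

Lemma mem_transporter N r y : (y \in transporter N r) = (r *: y \in N).
Proof. by []. Qed.

End Transporter.

(** * Correspondence between submodules of [V / J] and submodules above [J] *)

Section Quotient.
Variables (A : pzRingType) (V : lmodType A) (J : submodClosed V).
Implicit Types (N : submodClosed V) (K : submodClosed (quot_mod J)).

Fact preim_submod_closed K : submod_closed (fun x : V => mod_pi J x \in K).
Proof.
have memE x : (x \in (fun x : V => mod_pi J x \in K)) = (mod_pi J x \in K).
  by [].
split=> [|a x y]; rewrite !memE; first by rewrite /mod_pi raddf0 rpred0.
by move=> hx hy; rewrite mod_piD mod_piZ rpredD ?(rpredZ a hx).
Qed.
Definition preim_submod K := mk_submod (preim_submod_closed K).

Lemma mem_preim_submod K x : (x \in preim_submod K) = (mod_pi J x \in K).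
Proof. by []. Qed.

Lemma mod_pi_eq0 x : (mod_pi J x = 0) <-> (x \in J).
Proof.
have {1}<- : mod_pi J 0 = 0 by rewrite /mod_pi raddf0.
by split=> [/mod_piE|xJ]; last apply/mod_piE; rewrite subr0.
Qed.

Lemma sub_preim_submod K : {subset J <= preim_submod K}.
Proof.
by move=> x /mod_pi_eq0 xJ; rewrite mem_preim_submod xJ rpred0.
Qed.

Lemma mem_quot_submod N x : {subset J <= N} ->
  (mod_pi J x \in quot_submod J N) = (x \in N).
Proof.
move=> JN; apply/idP/idP => [/asboolP[y Ny /mod_piE/JN yxN]|Nx].
  by rewrite -(subKr y x) submodB.
by apply/asboolP; exists x.
Qed.

Lemma preim_submodK N : {subset J <= N} -> preim_submod (quot_submod J N) = N.
Proof.
by move=> JN; apply: submod_ext => x; rewrite mem_preim_submod mem_quot_submod.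
Qed.

Lemma quot_submodK K : quot_submod J (preim_submod K) = K.
Proof.
apply: submod_ext => q; rewrite -[q]mod_reprK.
by rewrite mem_quot_submod //; exact: sub_preim_submod.
Qed.

Lemma quot_submod_top : quot_submod J (top_submod V) = top_submod (quot_mod J).
Proof.
by apply/top_submodP => q; rewrite -[q]mod_reprK mem_quot_submod.
Qed.

Lemma quot_submod_self : quot_submod J J = zero_submod (quot_mod J).
Proof.
apply/zero_submodP => q; rewrite -[q]mod_reprK mem_quot_submod // => qJ.
by rewrite zero_submodE; apply/eqP/mod_pi_eq0.
Qed.

Lemma preim_Max K : Max (quot_mod J) K -> Max V (preim_submod K).
Proof.
move=> [Ktop maxK]; split=> [E|N KN].
  by apply: Ktop; rewrite -(quot_submodK K) E quot_submod_top.
have JN : {subset J <= N} by move=> x /(sub_preim_submod K)/KN.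
have [|E|E] := maxK (quot_submod J N).
- move=> q; rewrite -[q]mod_reprK mem_quot_submod // => qK.
  exact: (KN (mod_repr q)).
- by left; rewrite -(preim_submodK JN) E.
- by right; rewrite -(preim_submodK JN) E; apply/top_submodP.
Qed.

(** Together with [J], representatives of a finite generating set of [V / J] generate [V]. *)
Lemma fin_gen_quot : fin_gen (quot_mod J) ->
  exists s : seq V, forall N, {subset J <= N} -> {subset s <= N} ->
    N = top_submod V.
Proof.
case=> s sE; exists [seq mod_repr q | q <- s] => N JN sN.
rewrite -(preim_submodK JN); apply/top_submodP => x.
rewrite mem_preim_submod.
have : mod_pi J x \in span_submod [set q | q \in s] by rewrite sE.
apply: span_submod_min => q /= qs.
by rewrite -[q]mod_reprK mem_quot_submod //; apply: sN; exact: map_f.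
Qed.

End Quotient.

(** * Colon ideals of maximal submodules, and the sets [V^m] *)

Section Colon.
Variables (R : comPzRingType) (M : lmodType R).
Implicit Types (N K L Q S J X : submodClosed M) (T F : set (submodClosed M)).

Lemma mem_colon N (r : R) :
  ((r : R^o) \in colon N) <-> (forall x, r *: x \in N).
Proof. by split=> /asboolP. Qed.

Lemma colonS N L : {subset N <= L} -> {subset colon N <= colon L}.
Proof. by move=> NL r /mem_colon rN; apply/mem_colon => x; exact: NL. Qed.

Lemma colon_cap F (r : R) :
  ((r : R^o) \in colon (cap_submod F)) <->
  (forall Q, F Q -> (r : R^o) \in colon Q).
Proof.
split=> [/mem_colon h Q FQ|h].
  by apply/mem_colon => x; move/mem_cap_submod: (h x); apply.
apply/mem_colon => x; apply/mem_cap_submod => Q FQ.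
by move/mem_colon: (h Q FQ); apply.
Qed.

Lemma colon_top (r : R) : (r : R^o) \in colon (top_submod M).
Proof. exact/mem_colon. Qed.

Lemma colon1 N : ((1 : R^o) \in colon N) <-> N = top_submod M.
Proof.
rewrite -top_submodP (mem_colon N 1).
by split=> h x; move: (h x); rewrite scale1r.
Qed.

Lemma colon_mul N (a r : R) :
  (r : R^o) \in colon N -> (a * r : R^o) \in colon N.
Proof. by move=> hr; exact: (rpredZ a hr). Qed.

Lemma Max_colon1 Q : Max M Q -> (1 : R^o) \notin colon Q.
Proof. by move=> [Qtop _]; apply/negP => /colon1. Qed.

(** So [(Q : M)] is a maximal ideal. Some [x] has [r x] outside [Q], whence [x = a r x] modulo [Q]
    for some [a]; the elements that [1 - a r] sends into [Q] include [Q] and [x], hence are all of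
    [M]. *)
Lemma Max_colon_inv Q (r : R) : Max M Q -> (r : R^o) \notin colon Q ->
  exists a : R, (1 - a * r : R^o) \in colon Q.
Proof.
move=> maxQ /negP; rewrite (mem_colon Q r) => /existsNP[x /negP rxQ].
have [a haQ] := Max_adjoin x maxQ rxQ; exists a.
have xQ : x \notin Q by apply: contra rxQ => /(rpredZ r).
apply/mem_colon => y; rewrite -mem_transporter; move: y; apply/top_submodP.
have [|E|//] := maxQ.2 (transporter Q (1 - a * r)).
  by move=> y Qy; rewrite mem_transporter rpredZ.
case/negP: xQ; rewrite -E mem_transporter.
by rewrite scalerBl scale1r -scalerA.
Qed.

(** An [a] outside [(Q : M)] has an inverse [c] modulo that ideal, and [b] is then recovered from
    [a b]. *)
Lemma Max_colon_prime Q (a b : R) : Max M Q -> (a * b : R^o) \in colon Q ->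
  (a : R^o) \in colon Q \/ (b : R^o) \in colon Q.
Proof.
move=> maxQ abQ; have [|aQ] := boolP ((a : R^o) \in colon Q); first by left.
right; have [c cQ] := Max_colon_inv maxQ aQ.
have -> : b = b * (1 - c * a) + c * (a * b).
  by rewrite mulrBr mulr1 mulrCA (mulrC b a) subrK.
by apply: rpredD; apply: colon_mul.
Qed.

Lemma Vm_colonP N L : {subset colon N <= colon L} -> Vm L `<=` Vm N.
Proof. by move=> NL Q [maxQ LQ]; split=> // r /NL/LQ. Qed.

(** Closedness gives the inclusion from left to right: if [T = V^m(K)], then [(K : M)] lies in every
    [(P : M)] with [P] in [T], hence in the colon of their intersection. *)
Lemma Vm_cap T : T `<=` Max M -> Max_closed T -> Vm (cap_submod T) = T.
Proof.
move=> TMax [K TK]; apply/seteqP; split=> Q.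
  move=> QT; rewrite TK; move: QT; apply: Vm_colonP => r rK.
  by apply/colon_cap => P; rewrite TK => -[_]; apply.
by move=> TQ; split; [exact: TMax | move=> r /colon_cap; apply].
Qed.

Lemma Vm_subset_colon T N : T `<=` Vm N ->
  {subset colon N <= colon (cap_submod T)}.
Proof. by move=> TN r rN; apply/colon_cap => Q /TN[_]; apply. Qed.

(** The prime ideal [(Q : M)] contains one of two ideals whose product it contains. *)
Lemma Vm_mul N L Q : (forall a b : R, (a : R^o) \in colon N ->
    (b : R^o) \in colon L -> (a * b : R^o) \in colon Q) ->
  Max M Q -> Vm N Q \/ Vm L Q.
Proof.
move=> NLQ maxQ.
have [NQ|] := pselect {subset colon N <= colon Q}; first by left.
move=> /existsNP[a /not_implyP[aN aQ]]; right; split=> // b bL.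
by case: (Max_colon_prime maxQ (NLQ a b aN bL)).
Qed.

(** Generators suffice: [Ann M] is an ideal, so it contains the product of the two colon ideals once
    it contains every [a * b]. *)
Lemma submod_mul_eq0 N L : submod_mul N L = zero_submod M <->
  (forall a b : R, (a : R^o) \in colon N -> (b : R^o) \in colon L ->
     (a * b : R^o) \in Ann M).
Proof.
split=> [/zero_submodP h a b aN bL|h].
  apply/mem_colon => x; apply: h; apply: span_submod_gen.
  by exists (a * b); [apply: span_submod_gen; exists a, b | exists x].
apply/zero_submodP; apply: span_submod_min => _ [c cNL [x ->]].
suff /mem_colon : (c : R^o) \in Ann M by [].
move: c cNL; apply: (@span_submod_min R R^o) => _ [a [b [aN bL ->]]].
exact: h.
Qed.

End Colon.

(** * Colon ideals and vanishing products in [M / J] *)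

Section QuotientColon.
Variables (R : comPzRingType) (M : lmodType R) (J : submodClosed M).
Implicit Types (N K L : submodClosed M).

Lemma colon_quot N : {subset J <= N} ->
  colon (quot_submod J N) =i colon N.
Proof.
move=> JN r; apply/idP/idP => /mem_colon h; apply/mem_colon.
  by move=> x; rewrite -(mem_quot_submod _ JN) mod_piZ; exact: (h (mod_pi J x)).
by move=> q; rewrite -[q]mod_reprK -[_ *: _]mod_piZ mem_quot_submod.
Qed.

Lemma colon_preim (K : submodClosed (quot_mod J)) :
  colon (preim_submod K) =i colon K.
Proof.
by move=> r; rewrite -(colon_quot (@sub_preim_submod _ _ _ K)) quot_submodK.
Qed.

Lemma Ann_quot : Ann (quot_mod J) =i colon J.
Proof. by move=> r; rewrite /Ann -quot_submod_self colon_quot. Qed.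

Lemma quot_submod_mul_eq0 N L : {subset J <= N} -> {subset J <= L} ->
  submod_mul (quot_submod J N) (quot_submod J L) = zero_submod (quot_mod J) <->
  (forall a b : R, (a : R^o) \in colon N -> (b : R^o) \in colon L ->
     (a * b : R^o) \in colon J).
Proof.
move=> JN JL; rewrite submod_mul_eq0.
split=> h a b aN bL.
  by rewrite -Ann_quot; apply: h; rewrite colon_quot.
rewrite Ann_quot; apply: h; first by rewrite -(colon_quot JN).
by rewrite -(colon_quot JL).
Qed.

(** Since [(M : M) = R], the product of [M / J] and [K / J] vanishes exactly when
    [(K : M) <= (J : M)]. *)
Lemma AG_vertex_quot_top : J <> top_submod M ->
  AG_vertex (top_submod (quot_mod J)) <->
  (exists K, [/\ {subset J <= K}, K <> J, K <> top_submod M &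
                 {subset colon K <= colon J}]).
Proof.
move=> Jtop; split.
  case=> _ [K' [K0 Ktop]]; set K := preim_submod K'.
  have JK : {subset J <= K} by exact: sub_preim_submod.
  rewrite -quot_submod_top -{1}(quot_submodK K').
  move=> /quot_submod_mul_eq0-/(_ _ _) h; exists K; split=> //.
  - by move=> E; apply: K0; rewrite -(quot_submodK K') -/K E quot_submod_self.
  - by move=> E; apply: Ktop; rewrite -(quot_submodK K') -/K E quot_submod_top.
  - by move=> r rK; rewrite -[r]mul1r; apply: h => //; exact: colon_top.
case=> K [JK KJ Ktop KcJ]; split.
  rewrite -quot_submod_top -quot_submod_self => /(congr1 (@preim_submod _ _ _)).
  by rewrite !preim_submodK // => /esym.
exists (quot_submod J K); split.
- rewrite -quot_submod_self => /(congr1 (@preim_submod _ _ _)).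
  by rewrite !preim_submodK.
- rewrite -quot_submod_top => /(congr1 (@preim_submod _ _ _)).
  by rewrite !preim_submodK.
- rewrite -quot_submod_top; apply/quot_submod_mul_eq0 => // a b _ /KcJ.
  exact: colon_mul.
Qed.

End QuotientColon.

(** * Maximal submodules above [X], and adjacency *)

Section MaxAbove.
Variables (R : comPzRingType) (M : lmodType R).
Implicit Types (K P Q S X : submodClosed M) (T : set (submodClosed M)).

(** Take for [S] the intersection of all maximal submodules above [X], and let [J] be that of [T].
    From [J <= X <= S] comes [V^m(S) <= V^m(J) = T]; conversely [(S : M) <= (Q : M) <= (P : M)] for
    each [P] in [T]. *)
Lemma Vm_cap_Max_above T X : T !=set0 -> T `<=` Max M -> Max_closed T ->
  {subset cap_submod T <= X} ->
  (forall P, T P -> exists Q,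
     [/\ Max M Q, {subset X <= Q} & {subset colon Q <= colon P}]) ->
  exists S, [/\ semi_maximal S, {subset X <= S} & Vm S = T].
Proof.
move=> [P0 TP0] TMax Tcl JX above.
set F : set (submodClosed M) := [set Q | Max M Q /\ {subset X <= Q}].
have XS : {subset X <= cap_submod F}.
  by move=> x Xx; apply/mem_cap_submod => Q [_]; apply.
exists (cap_submod F); split=> //.
  exists F; split=> //; last by move=> Q [].
  by have [Q [maxQ XQ _]] := above _ TP0; exists Q.
apply/seteqP; split.
  rewrite -[X in _ `<=` X](Vm_cap TMax Tcl); apply: Vm_colonP; apply: colonS.
  by move=> x /JX/XS.
move=> P TP; split; first exact: TMax.
move=> r /colon_cap rF; have [Q [maxQ XQ QP]] := above _ TP.
by apply: QP; exact: rF.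
Qed.

(** Maximality of [(P : M)] in [R] passes to the quotient by [Ann (M / X) = (X : M)], which it
    contains. *)
Lemma quot_ideal_Max X P : Max M P -> {subset colon X <= colon P} ->
  Max (quot_ring (Ann (quot_mod X)))^o
    (quot_ideal (Ann (quot_mod X)) (colon P)).
Proof.
set I := Ann _ => maxP XP.
have IP : {subset I <= colon P} by move=> r; rewrite Ann_quot => /XP.
have memI (r : R) :
    (ring_pi I r : (quot_ring I)^o) \in quot_ideal I (colon P) ->
    (r : R^o) \in colon P.
  move=> /asboolP[x xP /ring_piE/IP xr].
  by have := submodB xP xr; rewrite opprB addrC subrK.
split=> [E|N PN].
  by case/negP: (Max_colon1 maxP); apply: memI; rewrite E.
have [NP|] := pselect {subset N <= quot_ideal I (colon P)}.
  by left; apply: submod_ext => q; apply/idP/idP => [/NP|/PN].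
move=> /existsNP[q /not_implyP[Nq qP]]; right.
set r := ring_repr q.
have rP : (r : R^o) \notin colon P.
  apply/negP => rP; apply: qP; apply/asboolP; exists r => //.
  exact: ring_reprK.
have [a aP] := Max_colon_inv maxP rP.
have N1 : (ring_pi I 1 : (quot_ring I)^o) \in N.
  (* The class of [1] is a multiple of [q] plus the class of an element of [(P : M)], both in
     [N]. *)
  have -> : ring_pi I 1 = ring_pi I a * q + ring_pi I (1 - a * r).
    rewrite -[q]ring_reprK -/r -[_ * _]ring_piM -ring_piD.
    by rewrite addrC subrK.
  rewrite rpredD //; first exact: (rpredZ (ring_pi I a) Nq).
  by apply: PN; apply/asboolP; exists (1 - a * r).
apply/top_submodP => p.
by have := rpredZ (p : quot_ring I) N1; rewrite [_ *: _]mulr1.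
Qed.

(** Surjectivity is applied to the maximal ideal [(P : M) / (X : M)]; the preimage in [M] of the
    submodule obtained is [Q]. *)
Lemma Max_surjective_above X P : Max_surjective (quot_mod X) ->
  Max M P -> {subset colon X <= colon P} ->
  exists Q, [/\ Max M Q, {subset X <= Q} & {subset colon Q <= colon P}].
Proof.
move=> surj maxP XP; case: surj => [M0|[_ surj]].
  (* [M / X = 0] would give [X = M], putting [1] in [(X : M)] and hence in [(P : M)]. *)
  case/negP: (Max_colon1 maxP); apply: XP; apply/colon1/top_submodP => x.
  exact/mod_pi_eq0/M0.
have [Q' maxQ' E] := surj _ (quot_ideal_Max maxP XP).
exists (preim_submod Q'); split; [exact: preim_Max|exact: sub_preim_submod|].
move=> r; rewrite colon_preim => rQ.
have : (ring_pi (Ann (quot_mod X)) r : (quot_ring _)^o)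
    \in quot_ideal (Ann (quot_mod X)) (colon P).
  by rewrite -E; apply/asboolP; exists r.
move=> /asboolP[x xP /ring_piE]; rewrite Ann_quot => /XP xr.
by have := submodB xP xr; rewrite opprB addrC subrK.
Qed.

(* A submodule [Q] maximal among those above [X] with [(Q : M)] inside the
   maximal ideal [p = (P : M)] is a maximal submodule: if [x] is not in [Q], some
   [r] outside [p] sends [M] into [Q + Rx].  Taking [x = a y] with [a] in [p]
   shows [pM] inside [Q], and then [Q + Rx = M] since [R = Rr + p]. *)
Lemma fin_gen_above J X P : fin_gen (quot_mod J) -> {subset J <= X} ->
  Max M P -> {subset colon X <= colon P} ->
  exists Q, [/\ Max M Q, {subset X <= Q} & {subset colon Q <= colon P}].
Proof.
move=> /fin_gen_quot[s sJ] JX maxP XP.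
pose C : set (submodClosed M) :=
  [set K : submodClosed M | {subset X <= K} /\ {subset colon K <= colon P}].
have [||Q [XQ QP] maxQ] := @Zorn_submod _ _ C.
- by exists X; split.
- move=> F F0 FC tot; have [K0 FK0] := F0.
  pose U := mk_submod (chain_submod_closed F0 tot).
  have FU K : F K -> {subset K <= U}.
    by move=> FK x Kx; apply/asboolP; exists K.
  exists U => //; split; first by move=> x /(FC K0 FK0).1/(FU K0 FK0).
  (* If [r] sends [M] into the union, it sends the finitely many generators into a single [K] of the
     chain, and [J] too, hence all of [M]. *)
  move=> r /mem_colon rU.
  have [x|K FK sK] := @chain_finite _ _ F [seq r *: x | x <- s] F0 tot.
    by move=> /mapP[y _ ->]; exact/asboolP/rU.
  apply: (FC K FK).2; apply/mem_colon => x; rewrite -mem_transporter.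
  move: x; apply/top_submodP/sJ => [x Jx|x xs]; rewrite mem_transporter.
    by rewrite rpredZ // (FC K FK).1 // JX.
  by apply: sK; exact: map_f.
have adj x : x \notin Q -> exists2 r : R, (r : R^o) \notin colon P &
    forall y, exists a : R, r *: y - a *: x \in Q.
  move=> xQ; apply: contrapT => noR.
  suff E : adjoin_submod Q x = Q by case/negP: xQ; rewrite -E adjoin_submod_gen.
  apply: maxQ; last exact: sub_adjoin_submod.
  split=> [y /XQ/sub_adjoin_submod//|r /mem_colon rx].
  apply: contrapT => /negP rP; apply: noR; exists r => // y.
  exact/mem_adjoin_submod.
have pM (a : R) y : (a : R^o) \in colon P -> a *: y \in Q.
  move=> aP; apply: contrapT => /negP ayQ.
  have [r rP rQ] := adj _ ayQ; have [b rybay] := rQ y.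
  have tP : (r - b * a : R^o) \notin colon P.
    apply: contra rP => tP.
    by rewrite -(subrK (b * a) r); apply: rpredD => //; exact: colon_mul.
  (* [r - b a] sends [y] into [Q], hence also every [c a y]. As [r z] is some [c a y] modulo [Q],
     the product lies in [(Q : M)], so in the prime [p], which contains neither factor. *)
  have : ((r - b * a) * r : R^o) \in colon Q.
    apply/mem_colon => z; have [c rzcay] := rQ z.
    have -> : ((r - b * a) * r) *: z = (r - b * a) *: (r *: z - c *: (a *: y))
        + (c * a) *: (r *: y - b *: (a *: y)).
      rewrite -[r *: y - _](_ : (r - b * a) *: y = _); last first.
        by rewrite scalerBl scalerA.
      by rewrite scalerBr !scalerA [(c * a) * _]mulrC mulrA subrK.
    by rewrite rpredD ?rpredZ.
  move=> /QP /(Max_colon_prime maxP)[tP'|rP']; first by rewrite tP' in tP.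
  by rewrite rP' in rP.
exists Q; split=> //; apply: MaxI.
  by move=> /colon1/QP; apply/negP; exact: Max_colon1.
move=> x xQ; have [r rP rQ] := adj _ xQ; have [b bP] := Max_colon_inv maxP rP.
apply/top_submodP => y; apply/mem_adjoin_submod; have [c cQ] := rQ y.
exists (b * c).
have -> : y - (b * c) *: x = (1 - b * r) *: y + b *: (r *: y - c *: x).
  by rewrite scalerBl scale1r scalerBr !scalerA addrA subrK.
by rewrite rpredD ?(rpredZ b) ?pM.
Qed.

(** Each non-inclusion serves twice: it makes one of [V^m(N)], [V^m(L)] different from [T], and it
    makes the other submodule proper. *)
Lemma AG_adj_G_adj T (N L : submodClosed M) :
  T !=set0 -> T `<=` Max M -> Max_closed T ->
  {subset cap_submod T <= N} -> {subset cap_submod T <= L} ->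
  AG_adj (quot_submod (cap_submod T) N) (quot_submod (cap_submod T) L) ->
  ~ {subset colon N <= colon (cap_submod T)} ->
  ~ {subset colon L <= colon (cap_submod T)} ->
  G_adj T N L.
Proof.
set J := cap_submod T => T0 TMax Tcl JN JL [_ _ NL NL0] NJ LJ.
have NLJ := (quot_submod_mul_eq0 JN JL).1 NL0.
have VT : Vm N `|` Vm L = T.
  apply/seteqP; split=> Q.
    rewrite -(Vm_cap TMax Tcl).
    by case; apply: Vm_colonP; exact: colonS.
  move=> TQ; apply: Vm_mul (TMax _ TQ) => a b aN bL.
  by have /colon_cap := NLJ a b aN bL; apply.
have neqT K : ~ {subset colon K <= colon J} -> Vm K <> T.
  by move=> KJ E; apply: KJ; apply: Vm_subset_colon; rewrite E.
(* With [K = M], the colon of [K] contains [1], so the product condition puts all of [(K' : M)] in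
   [(J : M)]. *)
have proper K K' : (forall a b : R, (a : R^o) \in colon K ->
    (b : R^o) \in colon K' -> (a * b : R^o) \in colon J) ->
    ~ {subset colon K' <= colon J} -> K <> top_submod M.
  move=> KK'J K'J Ktop; apply: K'J => b bK'; rewrite -[b]mul1r.
  by apply: KK'J => //; apply/colon1.
have Ntop : N <> top_submod M by exact: proper NLJ LJ.
have Ltop : L <> top_submod M.
  by apply: proper NJ => a b aL bN; rewrite mulrC; exact: NLJ.
split=> //; last by move=> E; apply: NL; rewrite E.
  by split=> //; exists L; split=> //; apply: neqT.
by split=> //; exists N; split=> //; [rewrite setUC|apply: neqT|apply: neqT].
Qed.

End MaxAbove.


(** * Adjacency under (a) or (b), and the finitely generated case of (a) *)

Theorem theorem4p5 (R : comNzRingType) (M : lmodType R)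
    (T : set (submodClosed M))
    (T_nonempty : T !=set0) (T_Max : T `<=` Max M) (T_closed : Max_closed T) :
  (forall N L : submodClosed M,
     {subset cap_submod T <= N} -> {subset cap_submod T <= L} ->
     AG_adj (quot_submod (cap_submod T) N) (quot_submod (cap_submod T) L) ->
     (~ AG_vertex (top_submod (quot_mod (cap_submod T)))
      \/
      [/\ Max_surjective (quot_mod N), Max_surjective (quot_mod L) &
          ~ exists S : submodClosed M,
              [/\ semi_maximal S, {subset N <= S} \/ {subset L <= S},
                  S <> cap_submod T & Vm S = T]]) ->
     G_adj T N L)
  /\
  (fin_gen (quot_mod (cap_submod T)) ->
   (~ exists S : submodClosed M,
        [/\ semi_maximal S, {subset cap_submod T <= S},
            S <> cap_submod T & Vm S = T]) ->
   ~ AG_vertex (top_submod (quot_mod (cap_submod T)))).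
Proof.
set J := cap_submod T.
have Jtop : J <> top_submod M.
  case: T_nonempty => Q TQ JT; case: (T_Max Q TQ) => + _; apply.
  apply/top_submodP => x; have : x \in J by rewrite JT.
  by move=> /mem_cap_submod; apply.
have neqJ X : quot_submod J X <> zero_submod (quot_mod J) -> X <> J.
  by move=> XJ E; apply: XJ; rewrite E quot_submod_self.
(* [S] differs from [J] because [J <= X <= S] and [X] is not [J]. *)
have no_S (X : submodClosed M) : {subset J <= X} -> X <> J ->
    (forall P, T P -> exists Q,
       [/\ Max M Q, {subset X <= Q} & {subset colon Q <= colon P}]) ->
    exists S, [/\ semi_maximal S, {subset X <= S}, S <> J & Vm S = T].
  move=> JX XJ above.
  have [S [semiS XS VS]] := Vm_cap_Max_above T_nonempty T_Max T_closed JX above.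
  exists S; split=> // E; apply: XJ.
  by apply: submod_ext => x; apply/idP/idP => [/XS|/JX//]; rewrite E.
(* If [(X : M) <= (J : M)], then under (a) [M / J] would be a vertex, and under (b) [X] would yield
   the excluded [S]. *)
have not_sub (X : submodClosed M) :
    {subset J <= X} -> AG_vertex (quot_submod J X) ->
    (~ AG_vertex (top_submod (quot_mod J)) \/
     Max_surjective (quot_mod X) /\ ~ exists S,
       [/\ semi_maximal S, {subset X <= S}, S <> J & Vm S = T]) ->
    ~ {subset colon X <= colon J}.
  move=> JX vX cond XcJ; have XJ := neqJ X vX.1.
  case: cond => [|[surjX]]; apply; last first.
    apply: no_S => // P TP; apply: Max_surjective_above (T_Max _ TP) _ => //.
    by move=> r /XcJ /colon_cap; apply.
  (* For [X = M] the vertex [X / J] is [M / J] itself; a proper [X] is a witness that [M / J] is a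
     vertex. *)
  have [Xtop|Xtop] := pselect (X = top_submod M).
    by rewrite -quot_submod_top -Xtop.
  by apply/(AG_vertex_quot_top Jtop); exists X.
split=> [N L JN JL adj cond|fg noS].
  have [vN vL _ _] := adj.
  apply: AG_adj_G_adj => //; apply: not_sub => //.
    case: cond => [|[surjN _ noS]]; [by left|right; split=> //].
    by move=> [S [semiS NS SJ VS]]; apply: noS; exists S; split=> //; left.
  case: cond => [|[_ surjL noS]]; [by left|right; split=> //].
  by move=> [S [semiS LS SJ VS]]; apply: noS; exists S; split=> //; right.
(* A vertex [M / J] provides [K] strictly above [J] with [(K : M) <= (J : M)]; finite generation
   supplies the maximal submodules above [K] from which the excluded [S] is built. *)
move=> /(AG_vertex_quot_top Jtop)[K [JK KJ Ktop KcJ]]; apply: noS.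
have [//|P TP|S [semiS KS SJ VS]] := no_S K JK.
  apply: (fin_gen_above fg JK); first exact: T_Max.
  by move=> r /KcJ /colon_cap; apply.
by exists S; split=> // x /JK/KS.
Qed.
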